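(* Let $(E,\nu)$ be a Euclidean domain that is not a field, let $B\in E$ be a nonzero nonunit, and let $d\in E$ be coprime to $B$. Then there is a unique $k\in E/dE$ satisfying the following condition for all $s\in E$: whenever $s=\beta B+s_0$ with $\beta,s_0\in E$ and either $s_0=0$ or $\nu(s_0)<\nu(B)$, one has $$s\equiv 0 \bmod d \iff \beta+k s_0\equiv 0 \bmod d .$$ Moreover, $k\equiv B^{-1} \bmod d$, i.e. $k$ is the multiplicative inverse of $B$ in $E/dE$.
   Context: A Euclidean domain $(E,\nu)$ is a commutative integral domain $E$ with unity together with a function $\nu:E\setminus\{0\}\to\mathbb{N}_0=\{0,1,2,\dots\}$ such that (a) for all $s\in E$ and $0\neq d\in E$ there exist $q,r\in E$ with $s=dq+r$ and $r=0$ or $\nu(r)<\nu(d)$ (quotient and remainder are not assumed unique); (b) $\nu(ab)\ge\nu(a)$ for all nonzero $a,b\in E$. Given a dividend $s$, its unit's digit $s_0$ and its ''rest'' $\beta$ are any elements with $s=\beta B+s_0$ and $s_0=0$ or $\nu(s_0)<\nu(B)$; one writes $s=\underline{\beta s_0}$. Since $\gcd(B,d)=1$, $B$ is invertible modulo $d$. *)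

(* Defs.v *)
From HB Require Import structures.
From mathcomp Require Import all_boot all_algebra.
From mathcomp Require Import boolp.

Set Implicit Arguments.
Unset Strict Implicit.
Unset Printing Implicit Defensive.

Import GRing.Theory.
Local Open Scope ring_scope.
Local Open Scope quotient_scope.

(* The Euclidean function is only defined on nonzero elements: it is encoded
   as a total function whose value at 0 is unconstrained and never used. *)
Record is_euclidean (E : idomainType) (nu : E -> nat) : Prop := {
  euclidean_division : forall s d : E, d != 0 ->
    exists q r : E, s = d * q + r /\ (r = 0 \/ (nu r < nu d)%N);
  euclidean_mul : forall a b : E, a != 0 -> b != 0 -> (nu a <= nu (a * b)%R)%N
}.

Definition divides (R : comNzRingType) (a b : R) : Prop := exists c, b = a * c.

Definition coprime_elts (R : comUnitRingType) (a b : R) : Prop :=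
  forall c : R, divides c a -> divides c b -> c \is a GRing.unit.

Section PrincipalQuotient.
Variables (R : comNzRingType) (d : R).

Definition principal_ideal : {pred R} := fun x => `[< divides d x >].

Lemma principal_ideal_zmod : zmod_closed principal_ideal.
Proof.
split; first by apply/asboolP; exists 0; rewrite mulr0.
move=> x y /asboolP[a ->] /asboolP[b ->]; apply/asboolP.
by exists (a - b); rewrite mulrBr.
Qed.

HB.instance Definition _ :=
  GRing.isZmodClosed.Build R principal_ideal principal_ideal_zmod.

(* MathComp puts a ring structure on R / I only when I is proper; here d may
   be a unit, so that R / dR may be the zero ring. *)
Definition quot_ring : Type := Quotient.quot principal_ideal.

HB.instance Definition _ := GRing.Zmodule.on quot_ring.

Definition residue : R -> quot_ring := \pi_(Quotient.quot principal_ideal).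

Lemma residue_eq x y : residue x = residue y <-> divides d (x - y).
Proof.
have E : (x == y %[mod Quotient.quot principal_ideal]) =
    (x - y \in principal_ideal) by rewrite Quotient.idealrBE.
split; first by move/eqP; rewrite E => /asboolP.
by move=> H; apply/eqP; rewrite E; apply/asboolP.
Qed.

Lemma residue_surj (k : quot_ring) : exists x, residue x = k.
Proof. by exists (repr (k : Quotient.quot principal_ideal)); apply: reprK. Qed.

Definition quot_one : quot_ring := residue 1.
Definition quot_mul (k l : quot_ring) : quot_ring :=
  residue (repr (k : Quotient.quot principal_ideal) *
           repr (l : Quotient.quot principal_ideal)).

Lemma residueM x y : residue (x * y) = quot_mul (residue x) (residue y).
Proof.
apply/residue_eq.
set x' := repr _; set y' := repr _.
have [a Ha] : divides d (x - x') by apply/residue_eq; rewrite /residue reprK.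
have [b Hb] : divides d (y - y') by apply/residue_eq; rewrite /residue reprK.
exists (a * y + x' * b).
by rewrite mulrDr mulrA -Ha mulrCA -Hb mulrBl mulrBr addrA subrK.
Qed.

Lemma quot_mulA : associative quot_mul.
Proof.
move=> k l m; have [x <-] := residue_surj k; have [y <-] := residue_surj l.
by have [z <-] := residue_surj m; rewrite -!residueM mulrA.
Qed.

Lemma quot_mulC : commutative quot_mul.
Proof.
move=> k l; have [x <-] := residue_surj k; have [y <-] := residue_surj l.
by rewrite -!residueM mulrC.
Qed.

Lemma quot_mul1 : left_id quot_one quot_mul.
Proof. by move=> k; have [x <-] := residue_surj k; rewrite -residueM mul1r. Qed.

Lemma residue_zmod : zmod_morphism residue.
Proof. by move=> x y; rewrite /residue raddfB. Qed.

HB.instance Definition _ :=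
  GRing.isZmodMorphism.Build R quot_ring residue residue_zmod.

Lemma quot_mulDl : left_distributive quot_mul +%R.
Proof.
move=> k l m; have [x <-] := residue_surj k; have [y <-] := residue_surj l.
by have [z <-] := residue_surj m; rewrite -raddfD -!residueM mulrDl raddfD.
Qed.

HB.instance Definition _ := GRing.Zmodule_isComPzRing.Build quot_ring
  quot_mulA quot_mulC quot_mul1 quot_mulDl.

Lemma residue_monoid : monoid_morphism residue.
Proof. by split=> // x y; rewrite residueM. Qed.

HB.instance Definition _ :=
  GRing.isMonoidMorphism.Build R quot_ring residue residue_monoid.

End PrincipalQuotient.

(* Main.v *)
Require Import Defs.
From mathcomp Require Import all_boot all_algebra.

Import GRing.Theory.
Local Open Scope ring_scope.

(* Bezout gives u with u B = 1 mod d; multiplying s = beta B + s0 by u shows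
   that u is a trimming multiplier.  Conversely, 1 is always an admissible unit's
   digit because nu 1 < nu B for a nonunit B, so the multiple 1 - u B of d, whose
   rest is - u and whose unit's digit is 1, forces any trimming multiplier to be
   u mod d. *)

(** Euclid's algorithm, by induction on a bound for [nu b]; a zero [b] or a zero remainder is
    treated apart, since [nu 0] is unconstrained. *)
Lemma euclidean_bezout (E : idomainType) (nu : E -> nat) (a b : E) :
  is_euclidean nu ->
  exists u v : E, divides (u * a + v * b) a /\ divides (u * a + v * b) b.
Proof.
move=> hE; move: {2}(nu b).+1 (ltnSn (nu b)) => n.
elim: n a b => // n IHn a b le_bn.
have [->|b0] := eqVneq b 0.
  exists 1, 0; rewrite mul1r mul0r addr0.
  by split; [exists 1; rewrite mulr1 | exists 0; rewrite mulr0].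
have [q [r [-> [->|lt_rb]]]] := euclidean_division hE a b0.
  exists 0, 1; rewrite mul0r mul1r add0r addr0.
  by split; [exists q | exists 1; rewrite mulr1].
have [u [v [[x gb] [y gr]]]] := IHn b r (leq_trans lt_rb le_bn).
(* Substituting [r = a - b * q] into [u * b + v * r] gives these coefficients. *)
exists v, (u - v * q).
have -> : v * (b * q + r) + (u - v * q) * b = u * b + v * r.
  by rewrite mulrDr mulrBl -mulrA [b * q]mulrC addrC addrA subrK.
split; last by exists x.
by exists (x * q + y); rewrite mulrDr mulrA -gb -gr.
Qed.

Lemma coprime_bezout (E : idomainType) (nu : E -> nat) (a b : E) :
  is_euclidean nu -> coprime_elts a b -> exists u v : E, u * a + v * b = 1.
Proof.
move=> hE cop; have [u [v [ga gb]]] := euclidean_bezout E nu a b hE.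
have gU := cop _ ga gb; move: gU; set g := _ + _ => gU.
exists (g^-1 * u), (g^-1 * v).
by rewrite -!mulrA -mulrDr -/g mulVr.
Qed.

(** Dividing 1 by [B] leaves a remainder [r], nonzero because [B] is not a unit, and
    [nu 1 <= nu (1 * r) < nu B]. *)
Lemma euclidean_nu1_lt (E : idomainType) (nu : E -> nat) (B : E) :
  is_euclidean nu -> B != 0 -> B \isn't a GRing.unit -> (nu 1%R < nu B)%N.
Proof.
move=> hE B0 BnU.
have [q [r [eq1 hr]]] := euclidean_division hE 1 B0.
have [r0|r0] := eqVneq r 0.
  case/negP: BnU; apply/unitrPr; exists q.
  by rewrite eq1 r0 addr0.
case: hr => [r_eq0|lt_rB]; first by rewrite r_eq0 eqxx in r0.
apply: leq_ltn_trans lt_rB.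
by have := euclidean_mul hE (oner_neq0 E) r0; rewrite mul1r.
Qed.

Theorem theorem1 (E : idomainType) (nu : E -> nat) (hE : is_euclidean nu)
    (hfield : ~ GRing.field_axiom E)
    (B d : E) (hB0 : B != 0) (hBu : B \isn't a GRing.unit)
    (hdB : coprime_elts B d) :
  let trims (k : quot_ring d) : Prop :=
    forall s beta s0 : E,
      s = beta * B + s0 -> (s0 = 0 \/ (nu s0 < nu B)%N) ->
      (residue d s = 0 <-> residue d beta + k * residue d s0 = 0) in
  (exists! k : quot_ring d, trims k) /\
  (forall k : quot_ring d, trims k -> k * residue d B = 1).
Proof.
move=> trims.
have [u [v uv1]] := coprime_bezout E nu B d hE hdB.
have rd0 : residue d d = 0.
  by rewrite -(rmorph0 (residue d)); apply/residue_eq; exists 1; rewrite subr0 mulr1.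
have uB1 : residue d u * residue d B = 1.
  by rewrite -(rmorph1 (residue d)) -uv1 rmorphD !rmorphM /= rd0 mulr0 addr0.
have trims_u k : trims k -> k = residue d u.
  move=> trims_k.
  have eq_s : v * d = - u * B + 1 by rewrite -uv1 mulNr addKr.
  have := (trims_k _ _ _ eq_s (or_intror (euclidean_nu1_lt E nu B hE hB0 hBu))).1.
  rewrite rmorphM /= rd0 mulr0 rmorph1 mulr1 rmorphN /= => /(_ erefl) /eqP.
  by rewrite addrC subr_eq0 => /eqP.
split; last by move=> k /trims_u ->.
exists (residue d u); split; last by move=> k /trims_u.
move=> s beta s0 -> _.
(* Modulo [d], [u * (beta * B) = beta] because [u * B = 1]. *)
have -> : residue d beta + residue d u * residue d s0 =
          residue d u * residue d (beta * B + s0).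
  by rewrite rmorphD rmorphM /= mulrDr mulrCA uB1 mulr1.
split=> [->|h]; first by rewrite mulr0.
(* The factor [u] is cancelled through its inverse [B]: [s = (u * B) * s = (u * s) * B]. *)
by rewrite -[LHS]mul1r -uB1 mulrAC h mul0r.
Qed.
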